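(* If $G\in\mathsf{TMD}$, then $\mathbb{G}=\mathrm{Aut}(\mathrm{M}(G))$ equipped with the tau-topology is a compact Hausdorff topological group.
   Context: All topological groups and flows are Hausdorff. For a topological group $G$, a $G$-flow is a compact space with a continuous left $G$-action $G\times X\to X$; it is minimal if every orbit is dense. The universal minimal flow $\mathrm{M}(G)$ is the (unique up to isomorphism) minimal $G$-flow which admits a continuous $G$-equivariant map onto every minimal $G$-flow. $\mathrm{Aut}(\mathrm{M}(G))$ is the group of $G$-equivariant homeomorphisms of $\mathrm{M}(G)$. For a symmetric open neighborhood $U$ of $e_G$ and a $G$-flow $X$, a nonempty open $A\subseteq X$ is $U$-TT if $A\subseteq\overline{UB}$ for every nonempty open $B\subseteq A$. A topological group $G$ is in $\mathsf{TMD}$ (has tractable minimal dynamics) if for every symmetric open neighborhood $U$ of $e_G$, every nonempty open $A\subseteq\mathrm{M}(G)$ contains a nonempty open $U$-TT set. Tau-topology on $\mathbb{G}$: the topology whose closure operator is, for $S\subseteq\mathbb{G}$ and $p\in\mathbb{G}$: $p\in\mathrm{cl}_\tau(S)$ iff $\{(x,p(x)):x\in\mathrm{M}(G)\}\subseteq\overline{\bigcup_{q\in S}\{(x,q(x)):x\in\mathrm{M}(G)\}}$, closure taken in $\mathrm{M}(G)\times\mathrm{M}(G)$. *)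

(* Defs.v *)
From HB Require Import structures.
From mathcomp Require Import all_boot.
From mathcomp Require Import all_classical topology.

Set Implicit Arguments.
Unset Strict Implicit.
Unset Printing Implicit Defensive.

Local Open Scope classical_set_scope.

(* Groups are written multiplicatively ([groupType], infinite groups allowed).
   Hausdorffness is not part of [is_topological_group]. *)

#[short(type="preTopologicalGroupType")]
HB.structure Definition PreTopologicalGroup := {G of Group G & Topological G}.

Definition is_topological_group (G : preTopologicalGroupType) : Prop :=
  continuous (fun z : G * G => (z.1 * z.2)%g) /\
  continuous (fun g : G => (g^-1)%g).

HB.mixin Record PreTopologicalGroup_isTopologicalGroup G
    & PreTopologicalGroup G := {
  topological_groupP : is_topological_group G
}.

#[short(type="topologicalGroupType")]
HB.structure Definition TopologicalGroup :=
  {G of PreTopologicalGroup G & PreTopologicalGroup_isTopologicalGroup G}.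

HB.mixin Record isFlow (G : topologicalGroupType) X & Topological X := {
  gact : G -> X -> X;
  gact1 : forall x, gact 1%g x = x;
  gactM : forall g h x, gact (g * h)%g x = gact g (gact h x);
  gact_continuous : continuous (fun z : G * X => gact z.1 z.2);
  flow_compact : compact [set: X];
  flow_hausdorff : hausdorff_space X
}.

#[short(type="flowType")]
HB.structure Definition Flow (G : topologicalGroupType) :=
  {X of Topological X & isFlow G X}.

(* The empty flow is excluded: were it minimal, it would have to be a factor
   of the universal minimal flow, which would then be empty too. *)
HB.mixin Record Flow_isMinimal (G : topologicalGroupType) X & Flow G X := {
  flow_nonempty : [set: X] !=set0;
  orbit_dense : forall x : X, dense [set gact g x | g in [set: G]]
}.

#[short(type="minimalFlowType")]
HB.structure Definition MinimalFlow (G : topologicalGroupType) :=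
  {X of Flow G X & Flow_isMinimal G X}.

Definition equivariant (G : topologicalGroupType) (X Y : flowType G)
  (f : X -> Y) : Prop := forall (g : G) (x : X), f (gact g x) = gact g (f x).

(* [M] is a model of M(G). *)
Definition universal_minimal_flow (G : topologicalGroupType)
    (M : minimalFlowType G) : Prop :=
  forall X : minimalFlowType G, exists f : M -> X,
    [/\ continuous f, equivariant f & range f = [set: X]].

Definition U_TT (G : topologicalGroupType) (X : flowType G)
    (U : set G) (A : set X) : Prop :=
  [/\ open A, A !=set0 &
      forall B : set X, open B -> B !=set0 -> B `<=` A ->
        A `<=` closure [set gact u b | u in U & b in B]].

(* G is in TMD, for [M] a model of M(G). *)
Definition tractable_minimal_dynamics (G : topologicalGroupType)
    (M : minimalFlowType G) : Prop :=
  forall U : set G, open U -> U 1%g -> [set (g^-1)%g | g in U] = U ->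
  forall A : set M, open A -> A !=set0 ->
  exists2 B : set M, B `<=` A & U_TT U B.

Section FlowAut.
Context (G : topologicalGroupType) (X : flowType G).

Record flow_aut := FlowAut {
  flow_aut_fun :> X -> X;
  flow_aut_continuous : continuous flow_aut_fun;
  flow_aut_equivariant : equivariant flow_aut_fun;
  flow_aut_homeo : exists h : X -> X,
    [/\ cancel flow_aut_fun h, cancel h flow_aut_fun & continuous h]
}.

HB.instance Definition _ := gen_eqMixin flow_aut.
HB.instance Definition _ := gen_choiceMixin flow_aut.

Lemma flow_autP (p q : flow_aut) : p =1 q -> p = q.
Proof.
case: p q => [p pc pe ph] [q qc qe qh] /= /funext pq; subst q.
by congr FlowAut; exact: Prop_irrelevance.
Qed.

Definition flow_aut1 : flow_aut.
Proof.
refine (@FlowAut idfun _ _ _).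
- by move=> x; exact: cvg_id.
- by [].
- by exists idfun; split=> // x; exact: cvg_id.
Defined.

Definition flow_autM (p q : flow_aut) : flow_aut.
Proof.
refine (@FlowAut (p \o q) _ _ _).
- move=> x; apply: continuous_comp; exact: flow_aut_continuous.
- by move=> g x /=; rewrite !flow_aut_equivariant.
- have [h [ph hp hc]] := flow_aut_homeo p.
  have [k [qk kq kc]] := flow_aut_homeo q.
  exists (k \o h); split; [exact: can_comp|exact: can_comp|].
  by move=> x; apply: continuous_comp; [exact: hc|exact: kc].
Defined.

Definition flow_aut_inv (p : flow_aut) : X -> X :=
  projT1 (cid (flow_aut_homeo p)).

Lemma flow_aut_invP (p : flow_aut) :
  [/\ cancel p (flow_aut_inv p), cancel (flow_aut_inv p) p &
      continuous (flow_aut_inv p)].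
Proof. exact: projT2 (cid (flow_aut_homeo p)). Qed.

Lemma flow_autVK (p : flow_aut) : cancel p (flow_aut_inv p).
Proof. by have [] := flow_aut_invP p. Qed.

Lemma flow_autKV (p : flow_aut) : cancel (flow_aut_inv p) p.
Proof. by have [] := flow_aut_invP p. Qed.

Definition flow_autV (p : flow_aut) : flow_aut.
Proof.
refine (@FlowAut (flow_aut_inv p) _ _ _).
- by have [] := flow_aut_invP p.
- move=> g x; rewrite -{1}(flow_autKV p x) -flow_aut_equivariant.
  by rewrite flow_autVK.
- exists p; split; [exact: flow_autKV|exact: flow_autVK|].
  exact: flow_aut_continuous.
Defined.

Lemma flow_autMA : associative flow_autM.
Proof. by move=> p q r; exact: flow_autP. Qed.

Lemma flow_aut1M : left_id flow_aut1 flow_autM.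
Proof. by move=> p; exact: flow_autP. Qed.

Lemma flow_autM1 : right_id flow_aut1 flow_autM.
Proof. by move=> p; exact: flow_autP. Qed.

Lemma flow_autVM : left_inverse flow_aut1 flow_autV flow_autM.
Proof. by move=> p; apply: flow_autP => x; exact: flow_autVK. Qed.

Lemma flow_autMV : right_inverse flow_aut1 flow_autV flow_autM.
Proof. by move=> p; apply: flow_autP => x; exact: flow_autKV. Qed.

HB.instance Definition _ := isGroup.Build flow_aut
  flow_autMA flow_aut1M flow_autM1 flow_autVM flow_autMV.

Definition aut_graph (p : flow_aut) : set (X * X) := range (fun x => (x, p x)).

Definition tau_cl (S : set flow_aut) : set flow_aut :=
  [set p | aut_graph p `<=` closure (\bigcup_(q in S) aut_graph q)].

Lemma tau_cl_sub (S : set flow_aut) : S `<=` tau_cl S.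
Proof.
by move=> p Sp z pz; apply: subset_closure; exists p.
Qed.

Lemma tau_clS (S T : set flow_aut) : S `<=` T -> tau_cl S `<=` tau_cl T.
Proof.
move=> ST p Sp; apply: (subset_trans Sp); apply: closureS.
exact: bigcup_subset.
Qed.

Lemma tau_cl_idem (S : set flow_aut) : tau_cl (tau_cl S) `<=` tau_cl S.
Proof.
move=> p pS; apply: (subset_trans pS).
have -> : closure (\bigcup_(q in S) aut_graph q) =
          closure (closure (\bigcup_(q in S) aut_graph q)).
  by apply/closure_id; exact: closed_closure.
by apply: closureS => z [q Sq]; exact: Sq.
Qed.

Lemma tau_cl0 : [set: X] !=set0 -> tau_cl set0 = set0.
Proof.
move=> [x _]; apply/seteqP; split=> // p /(_ (x, p x)).
by rewrite bigcup_set0 closure0; apply; exists x.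
Qed.

Lemma aut_graph_act (p : flow_aut) (z : X * X) (g : G) :
  aut_graph p z -> aut_graph p (gact g z.1, gact g z.2).
Proof. by move=> [x _ <-] /=; exists (gact g x) => //; rewrite flow_aut_equivariant. Qed.

Lemma gactr_continuous (g : G) : continuous (gact g : X -> X).
Proof.
move=> x; apply: (@continuous2_cvg _ _ _ _ _ _ (fun=> g) id gact).
- exact: (@gact_continuous G X (g, x)).
- exact: cvg_cst.
- exact: cvg_id.
Qed.

Lemma closure_graphs_act (S : set flow_aut) (z : X * X) (g : G) :
  closure (\bigcup_(q in S) aut_graph q) z ->
  closure (\bigcup_(q in S) aut_graph q) (gact g z.1, gact g z.2).
Proof.
move=> Sz B Bz.
have gc : (fun w : X * X => (gact g w.1, gact g w.2)) @ z -->
          (gact g z.1, gact g z.2).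
  apply: cvg_pair; apply: (@continuous_comp _ _ _ _ (gact g)).
  - exact: cvg_fst.
  - exact: gactr_continuous.
  - exact: cvg_snd.
  - exact: gactr_continuous.
have [w [[q Sq qw] Bw]] := Sz _ (gc _ Bz).
exists (gact g w.1, gact g w.2); split=> //.
by exists q => //; exact: aut_graph_act.
Qed.

End FlowAut.

Section TauTopology.
Context (G : topologicalGroupType) (M : minimalFlowType G).
Implicit Types S T : set (flow_aut M).

Lemma tau_clU S T : tau_cl (S `|` T) = tau_cl S `|` tau_cl T.
Proof.
apply/seteqP; split; last first.
  by move=> p [] /=; apply: tau_clS => q; [left|right].
move=> p /= pST.
have {}pST x : closure (\bigcup_(q in S) aut_graph q) (x, p x) \/
             closure (\bigcup_(q in T) aut_graph q) (x, p x).
  have : closure (\bigcup_(q in S `|` T) aut_graph q) (x, p x).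
    by apply: pST; exists x.
  by rewrite bigcup_setU closureU.
have key R x : closure (\bigcup_(q in R) aut_graph q) (x, p x) -> tau_cl R p.
  move=> Rx _ [y _ <-].
  pose D := [set y | closure (\bigcup_(q in R) aut_graph q) (y, p y)].
  have cD : closed D.
    have pc : continuous (fun y : M => (y, p y)).
      by move=> u; apply: cvg_pair; [exact: cvg_id|exact: flow_aut_continuous].
    by apply: (closed_comp (fun u _ => pc u)); exact: closed_closure.
  suff : D y by [].
  rewrite ((closure_id D).1 cD) => B By.
  have [V [Vo Vy VB]] : exists V, [/\ open V, V y & V `<=` B].
    by move: By; rewrite nbhsE => -[V [Vo Vy] VB]; exists V.
  have [w [Vw [g _ gw]]] := @orbit_dense G M x V (ex_intro _ y Vy) Vo.
  exists w; split; last exact: VB.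
  rewrite -gw /D /= flow_aut_equivariant.
  exact: (@closure_graphs_act _ _ R (x, p x) g).
have [x _] := @flow_nonempty G M.
by case: (pST x) => /key; [left|right].
Qed.

Definition tau_open S : Prop := tau_cl (~` S) `<=` ~` S.

Lemma tau_openT : tau_open setT.
Proof. by rewrite /tau_open setCT tau_cl0//; exact: flow_nonempty. Qed.

Lemma tau_openI : setI_closed tau_open.
Proof.
move=> S T So To; rewrite /tau_open setCI tau_clU.
by apply: setUSS.
Qed.

Lemma tau_open_bigU (I : Type) (f : I -> set (flow_aut M)) :
  (forall i, tau_open (f i)) -> tau_open (\bigcup_i f i).
Proof.
move=> fo; rewrite /tau_open setC_bigcup => p pf i _.
by apply: fo; apply: tau_clS pf; exact: bigcap_inf.
Qed.

(* The tau-topology on Aut(M): a set is closed iff it contains its [tau_cl].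
   By [closure_tauE] its closure operator is exactly [tau_cl]. *)
HB.instance Definition _ := isOpenTopological.Build (flow_aut M)
  tau_openT tau_openI tau_open_bigU.

Lemma closure_tauE S : closure S = tau_cl S.
Proof.
have opE (A : set (flow_aut M)) : open A = tau_open A by [].
apply/seteqP; split; last first.
  move=> p Sp; rewrite closureE => B [Bc SB].
  have := @tau_clS _ _ S B SB p Sp.
  by move: Bc; rewrite -openC opE /tau_open setCK => h /h.
rewrite closureE; apply: smallest_sub; last exact: tau_cl_sub.
by rewrite -openC opE /tau_open setCK; exact: tau_cl_idem.
Qed.

End TauTopology.

(* Main.v *)
Require Import Defs.
From HB Require Import structures.
From mathcomp Require Import all_boot.
From mathcomp Require Import all_classical topology.

Set Implicit Arguments.
Unset Strict Implicit.
Unset Printing Implicit Defensive.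

Local Open Scope classical_set_scope.

(** Write Aut(M) for the group of automorphisms of the universal minimal flow M.

    Compactness needs only universality. The limit of a filter on Aut(M) is
    sought inside the closed invariant set C of M x M obtained by intersecting
    the closures of the unions of graphs along the filter. By Zorn, C contains
    a minimal subflow, so by universality there is an equivariant map from M
    into C. Its two coordinates are endomorphisms of M. Every endomorphism of M
    is an automorphism ([universal_endo_aut]), so the image of that map is the
    graph of an automorphism p, and a graph inside C is exactly a cluster point
    of the filter ([graph_in_closed_invariant], [tau_compact]).

    That endomorphisms of M are invertible is the usual coalescence argument.
    Take a minimal left ideal L of the Ellis semigroup of M, inside M^M with
    the product topology. An equivariant map of M^M into L is, on L, right
    multiplication by an element of L, and right multiplications of a minimal
    left ideal are injective because the ideal contains an idempotent and every
    idempotent is a right identity ([minimal_ideal_injective]). If t is an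
    endomorphism of M, f : M -> L is given by universality and x is a point of
    M, then p |-> f (t (p x)) is such a map; it is injective on L, and
    evaluation at x sends L onto M, so t is injective.

    Tractability enters through one observation. For open A and B, the
    automorphisms r such that r(A) meets B form a tau-open set, because the
    complement forbids the graph from entering the open box A x B. If A is
    U-TT and r(A) meets both B and C, then some u in U moves a point of B into
    C ([U_TT_two_hits]): indeed r(A) is again U-TT. So at the scale U, all
    open sets met by r(A) look alike. Now if r and s are distinct, continuity
    of the action and tractability give a small U and a U-TT set A such that
    UU s(A) misses r(A) ([separating_TT]). An automorphism t such that t(A)
    meets both r(A) and s(A) would contradict this, so Aut(M) is Hausdorff.
    The same separation shows that the graphs of inversion and of
    multiplication are closed (multiplication uses [U_TT_two_hits] twice, which
    is why UU appears), and a map with closed graph into a compact Hausdorff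
    space is continuous. *)

(** * Minimal sets and closed graphs *)

(** Zorn's lemma applied to complements: by compactness, the intersection of a
    chain of nonempty closed sets is nonempty. It is used for invariant sets
    and for subsemigroups, both stable under arbitrary intersections. *)
Lemma minimal_closed_subset (T : topologicalType) (P : set T -> Prop)
    (C : set T) :
  compact [set: T] ->
  (forall F : set (set T), F `<=` P -> P (\bigcap_(A in F) A)) ->
  closed C -> C !=set0 -> P C ->
  exists L, [/\ L `<=` C, closed L, L !=set0, P L &
    forall K, K `<=` L -> closed K -> K !=set0 -> P K -> K = L].
Proof.
move=> cT PI cC C0 PC.
pose Q := [set O : set T | [/\ closed (C `\` O), C `\` O !=set0 & P (C `\` O)]].
have [F FQ Ftot|O [[cO O0 PO] Omax]] := @Zorn_bigcup T Q.
  (* C is added to the family so that an empty chain causes no trouble. *)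
  pose D := [set C `\` O | O in F] `|` [set C].
  have DE : C `\` \bigcup_(X in F) X = \bigcap_(A in D) A.
    apply/seteqP; split=> [x [Cx nFx] _ [[O FO <-]|->//]|x Dx].
      by split=> // Ox; apply: nFx; exists O.
    split; first by apply: (Dx C); right.
    by move=> [O FO Ox]; have [] := Dx (C `\` O) (or_introl (imageP _ FO)).
  have Dgood A : D A -> [/\ closed A, A !=set0 & P A].
    by move=> [[O /FQ[? ? ?] <-]|->].
  have FF : ProperFilter (filter_from D id).
    apply: filter_from_proper; last by move=> A /Dgood[].
    apply: filter_from_filter; first by exists C; right.
    have DC A : D A -> A `<=` C by move=> [[O _ <-]|->] // x [].
    move=> A B DA DB; case: (DA) => [[O FO AE]|->]; last first.
      by exists B => // x Bx; split=> //; exact: DC Bx.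
    case: (DB) => [[O' FO' BE]|->]; last first.
      by exists A => // x Ax; split=> //; exact: DC Ax.
    rewrite -AE -BE; case: (Ftot _ _ FO FO') => OO.
      exists (C `\` O'); first by left; exists O'.
      by move=> x [Cx nx]; split; split=> // /OO.
    exists (C `\` O); first by left; exists O.
    by move=> x [Cx nx]; split; split=> // /OO.
  split; rewrite DE.
  - by apply: (@closed_bigI _ _ D id) => A /Dgood[].
  - have [x [_ xF]] := cT _ FF filterT.
    exists x => A DA; have [cA _ _] := Dgood A DA.
    rewrite ((closure_id A).1 cA).
    by move: xF; rewrite clusterE; apply; exists A.
  - by apply: PI => A /Dgood[].
exists (C `\` O); split=> //.
move=> K KL cK K0 PK; apply: contrapT => KneL.
have CK : C `\` ~` K = K.
  apply/seteqP; split=> [x [_ /contrapT]//|x Kx].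
  by split=> //; have [] := KL x Kx.
apply: (Omax (~` K)); last by rewrite /Q /= CK.
split; first by move=> x Ox Kx; have [] := KL x Kx.
move=> KO; apply: KneL; apply/seteqP; split=> // x [Cx nOx].
by apply: contrapT => /KO.
Qed.

Lemma closed_eq (T U : topologicalType) (f g : T -> U) :
  hausdorff_space U -> continuous f -> continuous g ->
  closed [set x | f x = g x].
Proof.
move=> hU fc gc x xfg; apply: hU => A B Afx Bgx.
have nAB : nbhs x (f @^-1` A `&` g @^-1` B).
  by apply: filterI; [exact: fc|exact: gc].
have [y [/= fgy [Ay By]]] := xfg _ nAB.
by exists (f y); split=> //; rewrite fgy.
Qed.

(** The hypothesis is the closed graph condition in terms of neighborhoods. All
    cluster points of the image filter coincide with [f x], and compactness
    then forces convergence. *)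
Lemma closed_graph_continuous (T U : topologicalType) (f : T -> U) :
  hausdorff_space U -> compact [set: U] ->
  (forall x y, (forall A B, nbhs x A -> nbhs y B -> exists2 z, A z & B (f z)) ->
    y = f x) ->
  continuous f.
Proof.
move=> hU cU fgraph x.
have FF : ProperFilter (f @ x) := fmap_proper_filter _ (nbhs_pfilter x).
have fx y : cluster (f @ x) y -> y = f x.
  move=> xy; apply: fgraph => A B xA yB.
  have fA : (f @ x) (f @` A).
    by change (nbhs x (f @^-1` (f @` A))); apply: filterS xA => z Az; exists z.
  by have [_ [[z Az <-] Bz]] := xy _ _ fA yB; exists z.
apply: (compact_cluster_set1 hU cU) => //; try exact: filterT.
apply/seteqP; split=> [y /fx //|_ ->].
by have [y [_ Fy]] := cU _ FF filterT; rewrite -(fx y Fy).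
Qed.

(** * Product flows *)

Definition invariant (G : topologicalGroupType) (X : flowType G) (K : set X) :=
  forall g x, K x -> K (gact g x).

Section ProductFlow.
Context (G : topologicalGroupType) (X Y : flowType G).

Let act (g : G) (z : X * Y) : X * Y := (gact g z.1, gact g z.2).

Let act1 z : act 1%g z = z.
Proof. by case: z => x y; rewrite /act !gact1. Qed.

Let actM g h z : act (g * h)%g z = act g (act h z).
Proof. by rewrite /act !gactM. Qed.

Let act_continuous : continuous (fun w : G * (X * Y) => act w.1 w.2).
Proof.
move=> w; apply: cvg_pair.
  apply: (@continuous2_cvg _ _ _ _ _ _ fst (fst \o snd) gact).
  - exact: (@gact_continuous G X (w.1, w.2.1)).
  - exact: cvg_fst.
  - apply: continuous_comp; [exact: cvg_snd|exact: cvg_fst].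
apply: (@continuous2_cvg _ _ _ _ _ _ fst (snd \o snd) gact).
- exact: (@gact_continuous G Y (w.1, w.2.2)).
- exact: cvg_fst.
- apply: continuous_comp; exact: cvg_snd.
Qed.

Let prod_compact : compact [set: X * Y].
Proof. by rewrite -setXTT; apply: compact_setX; exact: flow_compact. Qed.

Let prod_hausdorff : hausdorff_space (X * Y)%type.
Proof.
move=> p q pq; rewrite [p]surjective_pairing [q]surjective_pairing.
congr pair; apply: flow_hausdorff => A B Ap Bq.
  have [z [/= Az Bz]] := pq (fst @^-1` A) (fst @^-1` B) (cvg_fst Ap) (cvg_fst Bq).
  by exists z.1.
have [z [/= Az Bz]] := pq (snd @^-1` A) (snd @^-1` B) (cvg_snd Ap) (cvg_snd Bq).
by exists z.2.
Qed.

HB.instance Definition _ := isFlow.Build G (X * Y)%type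
  act1 actM act_continuous prod_compact prod_hausdorff.

End ProductFlow.

Section PowerFlow.
Context (G : topologicalGroupType) (I : eqType) (X : flowType G).

Lemma ptws_continuous (T : topologicalType) (f : T -> {ptws I -> X}) :
  (forall i, continuous (f^~ i)) -> continuous f.
Proof.
move=> fc t; apply/cvg_sup => i.
exact: (@continuous_comp_initial _ _ _ (@proj I (fun=> X) i) f (fc i)).
Qed.

Lemma ptws_eval_continuous i : continuous (fun p : {ptws I -> X} => p i).
Proof. exact: (@proj_continuous I (fun=> X) i). Qed.

Let act (g : G) (p : {ptws I -> X}) : {ptws I -> X} := fun i => gact g (p i).

Let act1 p : act 1%g p = p.
Proof. by apply/funext => i; rewrite /act gact1. Qed.

Let actM g h p : act (g * h)%g p = act g (act h p).
Proof. by apply/funext => i; rewrite /act gactM. Qed.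

Let act_continuous : continuous (fun w : G * {ptws I -> X} => act w.1 w.2).
Proof.
apply: ptws_continuous => i w.
apply: (@continuous2_cvg _ _ _ _ _ _ fst (fun w => w.2 i) gact).
- exact: (@gact_continuous G X (w.1, w.2 i)).
- exact: cvg_fst.
- apply: (@continuous_comp _ _ _ snd (fun p : {ptws I -> X} => p i)).
    exact: cvg_snd.
  exact: ptws_eval_continuous.
Qed.

Let power_compact : compact [set: {ptws I -> X}].
Proof.
have := @tychonoff I (fun=> X) (fun=> setT) (fun=> @flow_compact G X).
by congr compact; apply/seteqP; split.
Qed.

Let power_hausdorff : hausdorff_space {ptws I -> X}.
Proof. by apply: hausdorff_product => _; exact: flow_hausdorff. Qed.

HB.instance Definition _ := isFlow.Build G {ptws I -> X}
  act1 actM act_continuous power_compact power_hausdorff.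

End PowerFlow.

(** * Maps from a universal minimal flow *)

Section Invariant.
Context (G : topologicalGroupType) (X : flowType G).

Lemma invariant_bigcap (F : set (set X)) :
  F `<=` @invariant G X -> invariant (\bigcap_(A in F) A).
Proof. by move=> FI g x Fx A FA; apply: FI => //; exact: Fx. Qed.

Lemma closure_orbit_invariant (x : X) :
  invariant (closure (range (fun g : G => gact g x))).
Proof.
move=> g y xy B By.
have [_ [[h _ <-] Bh]] := xy _ (@gactr_continuous _ _ g _ _ By).
by exists (gact g (gact h x)); split=> //; exists (g * h)%g => //; rewrite gactM.
Qed.

End Invariant.

Lemma minimal_flow_eq (G : topologicalGroupType) (M : minimalFlowType G)
    (K : set M) : closed K -> K !=set0 -> invariant K -> K = [set: M].
Proof.
move=> cK [x Kx] KI; apply/seteqP; split=> // y _; apply: cK => B.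
rewrite nbhsE => -[V [Vo Vy] VB].
have [w [Vw [g _ gw]]] := @orbit_dense G M x V (ex_intro _ y Vy) Vo.
by exists w; split; [rewrite -gw; exact: KI|exact: VB].
Qed.

(** A minimal closed invariant set [L], packaged as a minimal flow on the
    subtype of [L] so that universality can be applied to it. *)
Section MinimalSubflow.
Context (G : topologicalGroupType) (X : flowType G) (L : set X).
Hypotheses (L_closed : closed L) (L_nonempty : L !=set0)
  (L_invariant : invariant L)
  (L_minimal : forall K, K `<=` L -> closed K -> K !=set0 -> invariant K ->
    K = L).

Let act (g : G) (z : set_type L) : set_type L :=
  exist _ (gact g (set_val z)) (mem_set (@L_invariant g _ (set_mem (valP z)))).

Let act1 z : act 1%g z = z.
Proof. by apply: val_inj; rewrite /= gact1. Qed.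

Let actM g h z : act (g * h)%g z = act g (act h z).
Proof. by apply: val_inj; rewrite /= gactM. Qed.

Let val_continuous : continuous (set_val : set_type L -> X).
Proof. exact: initial_continuous. Qed.

Let act_continuous : continuous (fun w : G * set_type L => act w.1 w.2).
Proof.
apply: (@continuous_comp_initial (set_type L)) => w.
apply: (@continuous2_cvg _ _ _ _ _ _ fst (set_val \o snd) gact).
- exact: (@gact_continuous G X (w.1, set_val w.2)).
- exact: cvg_fst.
- by apply: continuous_comp; [exact: cvg_snd|exact: val_continuous].
Qed.

Let sub_compact : compact [set: set_type L].
Proof.
move=> F FF _.
have valL : set_val @^-1` L = [set: set_type L].
  by apply/seteqP; split=> // z _; exact: set_valP.
have FL : (set_val @ F) L.
  by change (F (set_val @^-1` L)); rewrite valL; exact: filterT.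
have cL : compact L :=
  subclosed_compact L_closed (@flow_compact G X) (@subsetT _ _).
have [x [Lx Fx]] := cL _ (fmap_proper_filter _ FF) FL.
exists (exist _ x (mem_set Lx)); split=> // A B FA [_ [[W oW <-] Wx] WB].
have FA' : (set_val @ F) (set_val @` A).
  change (F (set_val @^-1` (set_val @` A))).
  by apply: filterS FA => z Az; exists z.
have [_ [[z Az <-] Wz]] := Fx _ _ FA' (open_nbhs_nbhs (conj oW Wx)).
by exists z; split=> //; exact: WB.
Qed.

Let sub_hausdorff : hausdorff_space (set_type L).
Proof.
move=> p q pq; apply: val_inj; apply: flow_hausdorff => A B Ap Bq.
have [z [Az Bz]] := pq _ _ (val_continuous Ap) (val_continuous Bq).
by exists (set_val z).
Qed.

Let subflow : flowType G := HB.pack (set_type L)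
  (isFlow.Build G (set_type L) act1 actM act_continuous
    sub_compact sub_hausdorff).

Let sub_nonempty : [set: subflow] !=set0.
Proof. by have [x Lx] := L_nonempty; exists (exist _ x (mem_set Lx)). Qed.

Let orbit_closure x : L x -> closure (range (fun g : G => gact g x)) = L.
Proof.
move=> Lx; apply: L_minimal.
- rewrite (closure_id L).1//; apply: closureS => _ [g _ <-].
  exact: L_invariant.
- exact: closed_closure.
- by exists x; apply: subset_closure; exists 1%g => //; exact: gact1.
- exact: closure_orbit_invariant.
Qed.

Let sub_dense (z : subflow) : dense [set gact g z | g in [set: G]].
Proof.
move=> O [y Oy] [W oW WO].
have xL : closure (range (fun g : G => gact g (set_val z))) (set_val y).
  by rewrite orbit_closure; exact: set_valP.
have Wy : W (set_val y) by move: Oy; rewrite -WO.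
have [_ [[g _ <-] Wg]] := xL _ (open_nbhs_nbhs (conj oW Wy)).
by exists (gact g z); split; [rewrite -WO|exists g].
Qed.

Let minimal_subflow : minimalFlowType G := HB.pack (subflow : Type) subflow
  (Flow_isMinimal.Build G subflow sub_nonempty sub_dense).

Lemma universal_to_minimal (M : minimalFlowType G) :
  universal_minimal_flow M ->
  exists f : M -> X, [/\ continuous f, equivariant f & forall x, L (f x)].
Proof.
move=> /(_ minimal_subflow)[f [fc fe _]].
exists (fun x => set_val (f x : set_type L)); split.
- move=> x; apply: (@continuous_comp _ (set_type L)); first exact: fc.
  exact: val_continuous.
- by move=> g x; rewrite fe.
- by move=> x; exact: set_valP.
Qed.

End MinimalSubflow.

(** Universality becomes a selection principle: any nonempty closed invariant
    set receives a continuous equivariant map, whose image is a minimal part. *)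
Lemma universal_to_closed (G : topologicalGroupType) (M : minimalFlowType G)
    (X : flowType G) (C : set X) :
  universal_minimal_flow M -> closed C -> C !=set0 -> invariant C ->
  exists f : M -> X, [/\ continuous f, equivariant f & forall x, C (f x)].
Proof.
move=> MU cC C0 CI.
have [L [LC cL L0 LI Lmin]] := minimal_closed_subset (@flow_compact G X)
  (@invariant_bigcap G X) cC C0 CI.
have [f [fc fe fL]] := universal_to_minimal cL L0 LI Lmin MU.
by exists f; split=> // x; exact: LC.
Qed.

(** * Endomorphisms of a universal minimal flow are automorphisms *)

Section Coalescence.
Context (G : topologicalGroupType) (M : minimalFlowType G).
Local Notation MM := {ptws M -> M}.

Definition ellis_semigroup : set MM :=
  closure (range (fun g : G => gact g : MM)).

(** Composition, with operands typed in the product space [MM] so that its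
    topology is the one found on both sides. *)
Definition pcomp (p q : MM) : MM := p \o q.

Lemma pcomp_continuous (q : MM) : continuous (pcomp^~ q).
Proof. by apply: ptws_continuous => x; exact: ptws_eval_continuous. Qed.

(** The induction principle of a closure: a closed property of the translations
    by [G] passes to all their pointwise limits. *)
Lemma ellis_closed_ind (K : set MM) : closed K ->
  (forall g : G, K (gact g)) -> ellis_semigroup `<=` K.
Proof.
move=> cK Kg; rewrite /ellis_semigroup (closure_id K).1//.
by apply: closureS => _ [g _ <-].
Qed.

Lemma ellis_comp (K : set MM) : closed K -> invariant K ->
  forall p q, ellis_semigroup p -> K q -> K (pcomp p q).
Proof.
move=> cK KI p q Ep Kq; move: p Ep.
apply: (@ellis_closed_ind [set p | K (pcomp p q)]).
  by apply: (preimage_closed _ cK) => p _; exact: pcomp_continuous.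
by move=> g; exact: KI Kq.
Qed.

Lemma closed_right_translate (q : MM) (K : set MM) : closed K ->
  closed [set pcomp p q | p in K].
Proof.
move=> cK; apply: compact_closed; first exact: flow_hausdorff.
apply: continuous_compact.
  by apply: continuous_subspaceT; exact: pcomp_continuous.
exact: (subclosed_compact cK (@flow_compact G MM) (@subsetT _ _)).
Qed.

(** Ellis-Numakura. In a minimal closed subsemigroup [T], minimality gives
    [T t = T] for every [t] in [T], so the closed subsemigroup of those [p]
    with [p t = t] is nonempty, hence equal to [T] and contains [t]. *)
Lemma ellis_idempotent (S : set MM) : closed S -> S !=set0 ->
  (forall p q, S p -> S q -> S (pcomp p q)) ->
  exists2 u, S u & pcomp u u = u.
Proof.
move=> cS S0 SS.
pose sub (K : set MM) := forall p q, K p -> K q -> K (pcomp p q).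
have subI F : F `<=` sub -> sub (\bigcap_(A in F) A).
  by move=> FS p q Fp Fq A FA; apply: FS => //; [exact: Fp|exact: Fq].
have [T [TS cT [t Tt] TT Tmin]] :=
  minimal_closed_subset (@flow_compact G MM) subI cS S0 SS.
have Tt_T : [set pcomp p t | p in T] = T.
  apply: Tmin.
  - by move=> _ [p Tp <-]; exact: TT.
  - exact: closed_right_translate.
  - by exists (pcomp t t); exists t.
  - move=> _ _ [p Tp <-] [q Tq <-]; exists (pcomp (pcomp p t) q) => //.
    by apply: (TT) => //; exact: TT.
have [s Ts st] : [set pcomp p t | p in T] t by rewrite Tt_T.
have fixT : T `&` [set p | pcomp p t = t] = T.
  apply: Tmin.
  - by move=> p [].
  - apply: closedI => //.
    apply: closed_eq; first exact: (@flow_hausdorff G MM).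
      exact: pcomp_continuous.
    exact: cst_continuous.
  - by exists s.
  - move=> p q [Tp pt] [Tq qt]; split; first by apply: (TT).
    by rewrite /= -[pcomp _ t]/(pcomp p (pcomp q t)) qt.
exists t; first exact: TS.
by have [] : (T `&` [set p | pcomp p t = t]) t by rewrite fixT.
Qed.

(** An equivariant map commutes with the translations by [G], hence by
    continuity with left multiplication by their limits. *)
Lemma equivariant_ellis (h : MM -> MM) : continuous h -> equivariant h ->
  forall p q, ellis_semigroup p -> h (pcomp p q) = pcomp p (h q).
Proof.
move=> hc he p q Ep; move: p Ep.
apply: (@ellis_closed_ind [set p | h (pcomp p q) = pcomp p (h q)]).
  apply: closed_eq; first exact: (@flow_hausdorff G MM).
    move=> p; apply: (@continuous_comp _ _ _ (pcomp^~ q)).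
      exact: pcomp_continuous.
    exact: hc.
  exact: pcomp_continuous.
by move=> g; exact: he.
Qed.

(** With [u] an idempotent of [L], one has [h p = h (p u) = p w] on [L], where
    [w = h u]. Since [L w = L] there is [v] in [L] with [v w = u]; then [w v] is
    again idempotent, hence a right identity of [L], so right multiplication by
    [w] is undone by right multiplication by [v]. *)
Lemma minimal_ideal_injective (L : set MM) (h : MM -> MM) :
  L `<=` ellis_semigroup -> closed L -> L !=set0 -> invariant L ->
  (forall K, K `<=` L -> closed K -> K !=set0 -> invariant K -> K = L) ->
  continuous h -> equivariant h -> (forall p, L (h p)) ->
  forall p q, L p -> L q -> h p = h q -> p = q.
Proof.
move=> LE cL L0 LI Lmin hc he hL.
have LL p q : L p -> L q -> L (pcomp p q) by move=> /LE; exact: ellis_comp.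
have rightL w : L w -> [set pcomp p w | p in L] = L.
  move=> Lw; apply: Lmin.
  - by move=> _ [p Lp <-]; exact: LL.
  - exact: closed_right_translate.
  - by exists (pcomp w w); exists w.
  - by move=> g _ [p Lp <-]; exists (gact g p) => //; exact: LI.
have right_id e : L e -> pcomp e e = e -> forall p, L p -> pcomp p e = p.
  move=> Le ee p; rewrite -{1}(rightL e Le) => -[q Lq <-].
  by rewrite -[LHS]/(pcomp q (pcomp e e)) ee.
have [u Lu uu] := ellis_idempotent cL L0 LL.
pose w := h u.
have Lw : L w by exact: hL.
have [v Lv vw] : [set pcomp p w | p in L] u by rewrite rightL.
have wv : pcomp (pcomp w v) (pcomp w v) = pcomp w v.
  rewrite -[LHS]/(pcomp (pcomp w (pcomp v w)) v) vw.
  by rewrite (right_id u Lu uu w Lw).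
have wvL : L (pcomp w v) by exact: LL.
have hE p : L p -> h p = pcomp p w.
  move=> Lp; rewrite -{1}(right_id u Lu uu p Lp) equivariant_ellis//.
  exact: LE.
move=> p q Lp Lq; rewrite hE// hE// => pq.
rewrite -(right_id _ wvL wv p Lp) -(right_id _ wvL wv q Lq).
by rewrite -[LHS]/(pcomp (pcomp p w) v) pq.
Qed.

Hypothesis MU : universal_minimal_flow M.

(** The endomorphism [t] is transported to the map [p |-> f (t (p x))] of [M^M]
    into a minimal left ideal, which factors through [t] and evaluation at
    [x]. *)
Lemma universal_endo_injective (t : M -> M) :
  continuous t -> equivariant t -> injective t.
Proof.
move=> tc te.
have E0 : ellis_semigroup !=set0.
  by exists (gact 1%g); apply: subset_closure; exists 1%g.
have EI : invariant ellis_semigroup.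
  exact: (@closure_orbit_invariant G MM id).
have [L [LE cL L0 LI Lmin]] := minimal_closed_subset (@flow_compact G MM)
  (@invariant_bigcap G MM) (@closed_closure _ _) E0 EI.
have [f [fc fe fL]] := universal_to_closed MU cL L0 LI.
have [x _] := @flow_nonempty G M.
have evL : [set p x | p in L] = [set: M].
  apply: minimal_flow_eq.
  - apply: compact_closed; first exact: flow_hausdorff.
    apply: continuous_compact.
      by apply: continuous_subspaceT; exact: ptws_eval_continuous.
    exact: (subclosed_compact cL (@flow_compact G MM) (@subsetT _ _)).
  - by have [p Lp] := L0; exists (p x); exists p.
  - by move=> g _ [p Lp <-]; exists (gact g p) => //; exact: LI.
pose h (p : MM) : MM := f (t (p x)).
have hc : continuous h.
  move=> p; apply: (@continuous_comp _ _ _ (fun p : MM => p x) (f \o t)).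
    exact: ptws_eval_continuous.
  by apply: continuous_comp; [exact: tc|exact: fc].
have he : equivariant h by move=> g p; rewrite /h -fe -te.
move=> a b tab.
have [p Lp pa] : [set p x | p in L] a by rewrite evL.
have [q Lq qb] : [set p x | p in L] b by rewrite evL.
rewrite -pa -qb.
suff -> : p = q by [].
apply: (minimal_ideal_injective LE cL L0 LI Lmin hc he) => //.
  by move=> r; exact: fL.
by rewrite /h pa qb tab.
Qed.

Lemma universal_endo_aut (t : M -> M) :
  continuous t -> equivariant t -> exists p : flow_aut M, p =1 t.
Proof.
move=> tc te; have tI := universal_endo_injective tc te.
have timg K : closed K -> closed (t @` K).
  move=> cK; apply: compact_closed; first exact: flow_hausdorff.
  apply: continuous_compact; first exact: continuous_subspaceT.
  exact: (subclosed_compact cK (@flow_compact G M) (@subsetT _ _)).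
have tS : t @` setT = setT.
  apply: minimal_flow_eq; first exact/timg/closedT.
    by have [x _] := @flow_nonempty G M; exists (t x); exists x.
  by move=> g _ [x _ <-]; exists (gact g x).
have /choice[s st] y : exists x, t x = y.
  have [x _ tx] : (t @` setT) y by rewrite tS.
  by exists x.
have sK : cancel t s by move=> x; apply: tI; rewrite st.
have sc : continuous s.
  apply/continuous_closedP => K cK.
  rewrite (_ : s @^-1` K = t @` K); first exact: timg.
  apply/seteqP; split=> [y Ksy|_ [x Kx <-]]; first by exists (s y).
  by rewrite /= sK.
have th : exists h, [/\ cancel t h, cancel h t & continuous h] by exists s.
by exists (FlowAut tc te th).
Qed.

End Coalescence.

(** * Compactness of the tau-topology *)

Section TauCompact.
Context (G : topologicalGroupType) (M : minimalFlowType G).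
Hypothesis MU : universal_minimal_flow M.

(** An equivariant map [f] of [M] into [C] has automorphisms [a] and [b] as
    coordinates; reparametrized by the inverse of [a], its image is the graph
    of [b * a^-1]. *)
Lemma graph_in_closed_invariant (C : set (M * M)) :
  closed C -> C !=set0 -> invariant C ->
  exists p : flow_aut M, aut_graph p `<=` C.
Proof.
move=> cC C0 CI; have [f [fc fe fC]] := universal_to_closed MU cC C0 CI.
have [a aE] : exists a : flow_aut M, a =1 fst \o f.
  apply: universal_endo_aut => //.
    by move=> x; apply: continuous_comp; [exact: fc|exact: cvg_fst].
  by move=> g x; rewrite /= fe.
have [b bE] : exists b : flow_aut M, b =1 snd \o f.
  apply: universal_endo_aut => //.
    by move=> x; apply: continuous_comp; [exact: fc|exact: cvg_snd].
  by move=> g x; rewrite /= fe.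
exists (b * a^-1)%g => _ [y _ <-].
suff -> : (y, (b * a^-1)%g y) = f (flow_aut_inv a y) by [].
rewrite [RHS]surjective_pairing -[(f _).1]aE -[(f _).2]bE.
by rewrite flow_autKV.
Qed.

(** The graph of [p] lies in the set [C] below exactly when [p] is in the
    tau-closure of every member of the filter [F]. *)
Lemma tau_compact : compact [set: flow_aut M].
Proof.
move=> F FF _.
pose C := \bigcap_(S in F) closure (\bigcup_(q in S) aut_graph q).
have [x _] := @flow_nonempty G M.
have C0 : C !=set0.
  have [z [_ Fz]] := @flow_compact G (M * M)%type _
    (fmap_proper_filter (fun q : flow_aut M => (x, q x)) FF) filterT.
  exists z => S FS B zB; pose Sx := (fun q : flow_aut M => (x, q x)) @` S.
  have FSx : F ((fun q : flow_aut M => (x, q x)) @^-1` Sx).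
    by apply: filterS FS => q Sq; exists q.
  have [_ [[q Sq <-] Bq]] := Fz _ _ FSx zB.
  by exists (x, q x); split=> //; exists q => //; exists x.
have cC : closed C.
  by apply: closed_bigI => S _; exact: closed_closure.
have CI : invariant C.
  by move=> g z Cz S FS; exact: closure_graphs_act (Cz S FS).
have [p pC] := graph_in_closed_invariant cC C0 CI.
exists p; split=> //; rewrite clusterE => S FS.
by rewrite closure_tauE => z /pC; apply.
Qed.

End TauCompact.

(** * Open sets met by the images of a U-TT set *)

Section Hitting.
Context (G : topologicalGroupType) (M : minimalFlowType G).
Implicit Types (A B : set M) (p q r s : flow_aut M).

Definition hitting A B : set (flow_aut M) :=
  [set r | [set r x | x in A] `&` B !=set0].

(** In the complement of [hitting A B] all graphs avoid the open box [A `*` B],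
    and so do those in its tau-closure. *)
Lemma hitting_open A B : open A -> open B -> open (hitting A B).
Proof.
move=> oA oB; rewrite -[X in open X]setCK; apply: closed_openC.
rewrite closure_id closure_tauE; apply/seteqP; split; first exact: tau_cl_sub.
move=> r rcl [_ [[x Ax <-] Brx]].
have nAB : nbhs (x, r x) (A `*` B).
  by exists (A, B) => //; split; exact: open_nbhs_nbhs.
have [z [[q nq [y _ yz]] [Az Bz]]] :=
  rcl (x, r x) (ex_intro2 _ _ x I erefl) _ nAB.
by apply: nq; exists z.2; split=> //; exists z.1 => //; rewrite -yz.
Qed.

Lemma aut_image_open r A : open A -> open [set r x | x in A].
Proof.
move=> oA; rewrite (_ : [set r x | x in A] = flow_aut_inv r @^-1` A).
  by apply: open_comp => // x _; case: (flow_aut_invP r) => _ _; exact.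
apply/seteqP; split=> [_ [x Ax <-]|x Ax]; first by rewrite /= flow_autVK.
by exists (flow_aut_inv r x) => //; rewrite flow_autKV.
Qed.

Lemma nbhs_hitting r A : open A -> A !=set0 ->
  nbhs r (hitting A [set r x | x in A]).
Proof.
move=> oA [x Ax]; apply: open_nbhs_nbhs; split.
  by apply: hitting_open => //; exact: aut_image_open.
by exists (r x); split; exists x.
Qed.

(** The U-TT property of [A], applied to the part of [A] that [t] sends into
    [B], reaches a given point of [A] that [t] sends into [C]; [t] commutes with
    the action, so the conclusion is transported along [t]. *)
Lemma U_TT_two_hits (U : set G) A B C t : U_TT U A -> open B -> open C ->
  hitting A B t -> hitting A C t ->
  exists u b, [/\ U u, B b & C (gact u b)].
Proof.
move=> [oA A0 AU] oB oC [_ [[x Ax <-] Btx]] [_ [[y Ay <-] Cty]].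
have oAB : open (A `&` t @^-1` B).
  by apply: openI => //; apply: open_comp => // z _; exact: flow_aut_continuous.
have nC : nbhs y (t @^-1` C).
  exact/flow_aut_continuous/open_nbhs_nbhs.
have [_ [[u Uu [b [Ab Btb] <-]] Cub]] :=
  AU _ oAB (ex_intro _ x (conj Ax Btx)) (@subIsetl _ _ _) y Ay _ nC.
by exists u, (t b); split=> //; rewrite -flow_aut_equivariant.
Qed.

End Hitting.

(** * Separation and continuity of the group operations *)

Section Tractable.
Context (G : topologicalGroupType) (M : minimalFlowType G).
Hypothesis G_TMD : tractable_minimal_dynamics M.
Implicit Types (A B : set M) (p q r s : flow_aut M).

Lemma symmetric_nbhs_act (x : M) (S : set M) : nbhs x S ->
  exists U : set G, exists2 V : set M,
    [/\ open U, U 1%g, [set (g^-1)%g | g in U] = U, open V & V x] &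
    forall g h y, U g -> U h -> V y -> S (gact g (gact h y)).
Proof.
have [mulc invc] := @topological_groupP G.
move=> xS.
have xS1 : nbhs (gact (1%g : G) x) S by rewrite gact1.
have [[W V] [/= W1 Vx] WVS] := @gact_continuous G M (1%g, x) S xS1.
have W11 : nbhs (1 * 1 : G)%g W by rewrite mulg1.
have [[W2 W3] [/= W21 W31] W23] := mulc (1%g, 1%g) W W11.
have : nbhs (1%g : G) (W2 `&` W3) by exact: filterI.
rewrite nbhsE => -[N [oN N1] NW].
move: Vx; rewrite nbhsE => -[V' [oV' V'x] V'V].
exists (N `&` (fun g : G => g^-1)%g @^-1` N), V'.
  split=> //.
  - by apply: openI => //; apply: open_comp => // g _; exact: invc.
  - by split=> //=; rewrite invg1.
  - apply/seteqP; split=> [_ [g [Ng Ng'] <-]|g [Ng Ng']].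
      by split=> //=; rewrite invgK.
    by exists (g^-1)%g; [split=> //=; rewrite invgK|rewrite invgK].
move=> g h y [Ng _] [Nh _] V'y; rewrite -gactM.
apply: (WVS ((g * h)%g, y)); split; last exact: V'V.
apply: (W23 (g, h)); split; [exact: (NW _ Ng).1|exact: (NW _ Nh).2].
Qed.

(** At a point [x] with [r x <> s x], separate [r x] and [s x] by open sets,
    shrink the one around [s x] so that [UU] keeps it inside, and take a U-TT
    set inside the open set of points near [x]. *)
Lemma separating_TT r s : r <> s ->
  exists U : set G, exists2 A, U 1%g /\ U_TT U A &
    forall u v x y, U u -> U v -> A x -> A y -> r y <> gact u (gact v (s x)).
Proof.
move=> rs; have [x /eqP rsx] : exists x, r x <> s x.
  by apply/existsNP => rsE; apply: rs; exact: flow_autP.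
have := @flow_hausdorff G M; rewrite open_hausdorff => /(_ _ _ rsx).
move=> [[R S] /= [/set_mem Rr /set_mem Ss] [oR oS /eqP RS]].
have [U [V [oU U1 Usym oV Vs] UV]] :=
  symmetric_nbhs_act (open_nbhs_nbhs (conj oS Ss)).
have oRV : open (r @^-1` R `&` s @^-1` V).
  by apply: openI; apply: open_comp => // y _; exact: flow_aut_continuous.
have [A ARV ATT] := G_TMD oU U1 Usym oRV (ex_intro _ x (conj Rr Vs)).
exists U, A => // u v y z Uu Uv Ay Az rz.
have : (R `&` S) (r z).
  split; first exact: (ARV z Az).1.
  by rewrite rz; apply: UV => //; exact: (ARV y Ay).2.
by rewrite RS.
Qed.

Lemma tau_hausdorff : hausdorff_space (flow_aut M).
Proof.
move=> r s rs; apply: contrapT => /separating_TT[U [A [U1 ATT] AD]].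
have [oA A0 _] := ATT.
have [t [tr ts]] := rs _ _ (nbhs_hitting r oA A0) (nbhs_hitting s oA A0).
have [u [_ [Uu [x Ax <-] [y Ay ruy]]]] :=
  U_TT_two_hits ATT (aut_image_open s oA) (aut_image_open r oA) ts tr.
by apply: (AD _ _ x y Uu U1 Ax Ay); rewrite ruy gact1.
Qed.

Hypothesis tau_c : compact [set: flow_aut M].

(** With [B = p^-1(A)], automorphisms [q] close to [p] satisfy that [q(B)] meets
    [A], which says that [q^-1(A)] meets [p^-1(A)]. *)
Lemma tau_inv_continuous : continuous (fun p : flow_aut M => (p^-1)%g).
Proof.
apply: (@closed_graph_continuous (flow_aut M) (flow_aut M)) => //.
  exact: tau_hausdorff.
move=> p r rp; apply: contrapT => /separating_TT[U [A [U1 ATT] AD]].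
have [oA A0 _] := ATT; set s := (p^-1)%g in AD *.
have oB : open [set s x | x in A] by exact: aut_image_open.
have pB : hitting [set s x | x in A] A p.
  have [x Ax] := A0; exists x; split=> //.
  by exists (s x); [exists x|rewrite [LHS]flow_autKV].
have hitV q : hitting [set s x | x in A] A q ->
    hitting A [set s x | x in A] (q^-1)%g.
  move=> [_ [[y By <-] Aqy]]; exists y; split=> //.
  by exists (q y) => //; rewrite [LHS]flow_autVK.
have := open_nbhs_nbhs (conj (hitting_open oB oA) pB) => /(filterS hitV) nV.
have [t' tB tr] := rp _ _ nV (nbhs_hitting r oA A0).
have [u [_ [Uu [x Ax <-] [y Ay ruy]]]] :=
  U_TT_two_hits ATT oB (aut_image_open r oA) tB tr.
by apply: (AD _ _ x y Uu U1 Ax Ay); rewrite ruy gact1.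
Qed.

(** Let [p'] and [q'] be close to [p] and [q], with [p' q'] close to [r], and
    let [s = p q]. The set [q'(A)] meets both [q(A)] and the preimage of [r(A)]
    by [p'], so some [u] in [U] moves a point of [q(A)] into that preimage. Hence
    [p' q(A)] meets the preimage of [r(A)] by [u]; it also meets [s(A)], so some
    [v] in [U] moves a point of [s(A)] into the latter preimage, and [u v] moves
    it into [r(A)]. *)
Lemma tau_mul_continuous :
  continuous (fun z : flow_aut M * flow_aut M => (z.1 * z.2)%g).
Proof.
apply: (@closed_graph_continuous (flow_aut M * flow_aut M)%type
  (flow_aut M)) => //.
  exact: tau_hausdorff.
move=> [p q] r rpq; apply: contrapT => /separating_TT[U [A [U1 ATT] AD]].
have [oA A0 _] := ATT; set s := (p * q)%g in AD *.
pose qA := [set q x | x in A].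
have oqA : open qA by exact: aut_image_open.
have qA0 : qA !=set0 by have [x Ax] := A0; exists (q x); exists x.
have nV : nbhs (p, q) (hitting qA [set p x | x in qA] `*` hitting A qA).
  by exists (hitting qA [set p x | x in qA], hitting A qA) => //;
     split; exact: nbhs_hitting.
have [[p' q'] [/= pH qH] [_ [[y Ay <-] ry]]] :=
  rpq _ _ nV (nbhs_hitting r oA A0).
have orA : open [set r x | x in A] by exact: aut_image_open.
have osA : open [set s x | x in A] by exact: aut_image_open.
have oP : open (p' @^-1` [set r x | x in A]).
  by apply: open_comp => // x _; exact: flow_aut_continuous.
have q'P : hitting A (p' @^-1` [set r x | x in A]) q'.
  by exists (q' y); split=> //; exists y.
have [u [_ [Uu [x Ax <-] ]]] := U_TT_two_hits ATT oqA oP qH q'P.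
rewrite /= flow_aut_equivariant => urA.
have oQ : open (gact u @^-1` [set r x | x in A]).
  by apply: open_comp => // z _; exact: gactr_continuous.
have pqQ : hitting A (gact u @^-1` [set r x | x in A]) (p' * q)%g.
  by exists (p' (q x)); split=> //; exists x.
have pqs : hitting A [set s x | x in A] (p' * q)%g.
  move: pH => [_ [[_ [x1 Ax1 <-] <-] [_ [x2 Ax2 <-] px]]].
  by exists (p' (q x1)); split; [exists x1|exists x2].
have [v [_ [Uv [x' Ax' <-] [y' Ay' ry']]]] := U_TT_two_hits ATT osA oQ pqs pqQ.
exact: (AD _ _ x' y' Uu Uv Ax' Ay').
Qed.

End Tractable.

Theorem corollary8p17 (G : topologicalGroupType) (M : minimalFlowType G)
    (G_hausdorff : hausdorff_space G)
    (M_universal : universal_minimal_flow M)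
    (G_TMD : tractable_minimal_dynamics M) :
  [/\ is_topological_group (flow_aut M),
      compact [set: flow_aut M] &
      hausdorff_space (flow_aut M)].
Proof.
have tau_c := tau_compact M_universal.
split=> //; last exact: tau_hausdorff.
by split; [exact: tau_mul_continuous|exact: tau_inv_continuous].
Qed.
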